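(* Let $T:V\to\mathfrak{g}$ be an $\mathcal{O}$-operator on a hom-Lie algebra $(\mathfrak{g},[\cdot,\cdot],\alpha)$ with respect to a representation $(V,\beta,\rho)$. Define $\rho_T:V\to\mathrm{End}(\mathfrak{g})$ by $$\rho_T(v)(x):=[Tv,x]+T\{x,v\},\qquad v\in V,\ x\in\mathfrak{g}.$$ Then $(\mathfrak{g},\alpha,\rho_T)$ is a representation of the sub-adjacent hom-Lie algebra $V^c_\beta=(V,[\cdot,\cdot]^c,\beta)$.
   Context: The base field $k$ has characteristic zero. A (multiplicative) hom-Lie algebra $(\mathfrak{g},[\cdot,\cdot],\alpha)$ is a vector space $\mathfrak{g}$ with a skew-symmetric bilinear bracket and a linear map $\alpha:\mathfrak{g}\to\mathfrak{g}$ with $\alpha[x,y]=[\alpha(x),\alpha(y)]$ and $[\alpha(x),[y,z]]+[\alpha(y),[z,x]]+[\alpha(z),[x,y]]=0$ for all $x,y,z$. A representation $(V,\beta,\rho)$ is a vector space $V$, $\beta\in\mathrm{End}(V)$ and a linear map $\rho:\mathfrak{g}\to\mathrm{End}(V)$ with $\rho(\alpha(x))(\beta(v))=\beta(\rho(x)(v))$ and $\rho([x,y])(\beta(v))=\rho(\alpha(x))\rho(y)(v)-\rho(\alpha(y))\rho(x)(v)$. Write $\{x,v\}:=\rho(x)(v)$. An $\mathcal{O}$-operator on $(\mathfrak{g},[\cdot,\cdot],\alpha)$ with respect to $(V,\beta,\rho)$ is a linear map $T:V\to\mathfrak{g}$ with $T\circ\beta=\alpha\circ T$ and $[Tu,Tv]=T(\{Tu,v\}-\{Tv,u\})$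 for all $u,v\in V$. The $\mathcal{O}$-operator $T$ induces a hom-pre-Lie product $v\cdot_T w=\{Tv,w\}$ on $(V,\beta)$; the sub-adjacent hom-Lie algebra $V^c_\beta=(V,[\cdot,\cdot]^c,\beta)$ has bracket $[v,w]^c=v\cdot_T w-w\cdot_T v=\{Tv,w\}-\{Tw,v\}$. *)

(* Defs.v *)
From HB Require Import structures.
From mathcomp Require Import all_boot all_order all_algebra.
From mathcomp Require Import sesquilinear.

Set Implicit Arguments.
Unset Strict Implicit.
Unset Printing Implicit Defensive.

Import GRing.Theory.
Local Open Scope ring_scope.

Record homLieAlgebra (k : fieldType) := HomLieAlgebra {
  hl_sort :> lmodType k;
  hl_bracket : hl_sort -> hl_sort -> hl_sort;
  hl_twist : {linear hl_sort -> hl_sort};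
  hl_bracket_bilinear : bilinear_for *:%R *:%R hl_bracket;
  hl_bracket_skew : forall x y, hl_bracket x y = - hl_bracket y x;
  hl_twist_bracket : forall x y,
    hl_twist (hl_bracket x y) = hl_bracket (hl_twist x) (hl_twist y);
  hl_jacobi : forall x y z,
    hl_bracket (hl_twist x) (hl_bracket y z)
    + hl_bracket (hl_twist y) (hl_bracket z x)
    + hl_bracket (hl_twist z) (hl_bracket x y) = 0
}.

Arguments hl_bracket {k} g x y : rename.
Arguments hl_twist {k} g : rename.

(* A linear map rho : g -> End(V) is encoded in curried form, as a bilinear
   map g -> V -> V; V may be infinite dimensional. *)
Record representation (k : fieldType) (g : homLieAlgebra k) (V : lmodType k)
    (beta : {linear V -> V}) (rho : g -> V -> V) : Prop := Representation {
  rep_bilinear : bilinear_for *:%R *:%R rho;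
  rep_twist : forall x v, rho (hl_twist g x) (beta v) = beta (rho x v);
  rep_bracket : forall x y v,
    rho (hl_bracket g x y) (beta v)
    = rho (hl_twist g x) (rho y v) - rho (hl_twist g y) (rho x v)
}.

Record O_operator (k : fieldType) (g : homLieAlgebra k) (V : lmodType k)
    (beta : {linear V -> V}) (rho : g -> V -> V) (T : {linear V -> g}) : Prop :=
  OOperator {
  O_twist : forall v, T (beta v) = hl_twist g (T v);
  O_bracket : forall u v,
    hl_bracket g (T u) (T v) = T (rho (T u) v - rho (T v) u)
}.

Section SubAdjacent.

Variables (k : fieldType) (g : homLieAlgebra k) (V : lmodType k).
Variables (beta : {linear V -> V}) (rho : g -> V -> V) (T : {linear V -> g}).

Definition preLie_product (v w : V) : V := rho (T v) w.

Definition subadjacent_bracket (v w : V) : V :=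
  preLie_product v w - preLie_product w v.

Hypothesis rhoP : representation beta rho.
Hypothesis TP : O_operator beta rho T.

Lemma preLie_product_bilinear : bilinear_for *:%R *:%R preLie_product.
Proof.
case: (rep_bilinear rhoP) => linl linr; split=> [v a u w | u a v w].
  by rewrite /preLie_product linearP; exact: linl.
exact: linr.
Qed.

Lemma subadjacent_bracket_bilinear :
  bilinear_for *:%R *:%R subadjacent_bracket.
Proof.
case: preLie_product_bilinear => linl linr.
split=> [v a u w | u a v w]; rewrite /subadjacent_bracket.
  have /= -> := linl v a u w; have /= -> := linr v a u w.
  by rewrite scalerBr opprD addrACA.
have /= -> := linr u a v w; have /= -> := linl u a v w.
by rewrite scalerBr opprD addrACA.
Qed.

Lemma subadjacent_bracket_skew v w :
  subadjacent_bracket v w = - subadjacent_bracket w v.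
Proof. by rewrite /subadjacent_bracket opprB. Qed.

Lemma twist_subadjacent_bracket v w :
  beta (subadjacent_bracket v w) = subadjacent_bracket (beta v) (beta w).
Proof.
rewrite /subadjacent_bracket /preLie_product linearB !(O_twist TP).
by rewrite !(rep_twist rhoP).
Qed.

Lemma subadjacent_jacobi u v w :
  subadjacent_bracket (beta u) (subadjacent_bracket v w)
  + subadjacent_bracket (beta v) (subadjacent_bracket w u)
  + subadjacent_bracket (beta w) (subadjacent_bracket u v) = 0.
Proof.
have rhoB x y z : rho x (y - z) = rho x y - rho x z.
  have [_ /(_ x (-1) z y) /= E] := rep_bilinear rhoP.
  by rewrite !scaleN1r in E; rewrite addrC E addrC.
have E a b c : subadjacent_bracket (beta a) (subadjacent_bracket b c)
    = rho (hl_twist g (T a)) (rho (T b) c)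
      - rho (hl_twist g (T a)) (rho (T c) b)
      + (rho (hl_twist g (T c)) (rho (T b) a)
         - rho (hl_twist g (T b)) (rho (T c) a)).
  rewrite /subadjacent_bracket /preLie_product -(O_bracket TP) (O_twist TP).
  by rewrite rhoB (rep_bracket rhoP) opprB.
rewrite !{}E.
move: (rho _ (rho (T v) w)) (rho _ (rho (T w) v)) => a b.
move: (rho _ (rho (T w) u)) (rho _ (rho (T u) w)) => c d.
move: (rho _ (rho (T v) u)) (rho _ (rho (T u) v)) => e f.
rewrite [X in X + _]addrA -(addrA (a - b)) subrKA.
by rewrite [X in X + _]addrAC !subrKA addrACA !subrKA subrr.
Qed.

Definition subadjacent : homLieAlgebra k :=
  HomLieAlgebra subadjacent_bracket_bilinear subadjacent_bracket_skew
    twist_subadjacent_bracket subadjacent_jacobi.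

Definition rho_T (v : V) (x : g) : g := hl_bracket g (T v) x + T (rho x v).

End SubAdjacent.

(* Main.v *)
(* Since [T u] brackets into the image of [T], the terms [{T{x, w}, beta v}]
   in [rho_T (beta v) (rho_T w x)] cancel, which leaves
     [alpha Tv, [Tw, x]]
     + T ({alpha Tv, {x, w}} + {alpha Tw, {x, v}} - {alpha x, {Tw, v}}).
   Antisymmetrizing in v and w, the two middle terms drop out as their sum is
   symmetric; the hom-Jacobi identity treats the first term, and the last one
   is [T {alpha x, [v, w]^c}]. *)
Require Import Defs.
From HB Require Import structures.
From mathcomp Require Import all_boot all_order all_algebra.
From mathcomp Require Import sesquilinear.

Set Implicit Arguments.
Unset Strict Implicit.
Unset Printing Implicit Defensive.

Import GRing.Theory.
Local Open Scope ring_scope.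

Lemma hl_bracketDr (k : fieldType) (g : homLieAlgebra k) (x y z : g) :
  hl_bracket g x (y + z) = hl_bracket g x y + hl_bracket g x z.
Proof.
have [_ /(_ x 1 y z) /= E] := hl_bracket_bilinear g.
by rewrite !scale1r in E.
Qed.

Lemma hl_bracketNr (k : fieldType) (g : homLieAlgebra k) (x y : g) :
  hl_bracket g x (- y) = - hl_bracket g x y.
Proof.
have E0 : hl_bracket g x 0 = 0.
  by apply: (addrI (hl_bracket g x 0)); rewrite -hl_bracketDr !addr0.
by apply: (addrI (hl_bracket g x y)); rewrite -hl_bracketDr !subrr.
Qed.

(** Skew-symmetry turns the cyclic hom-Jacobi sum into [rep_bracket] for the adjoint action, the
    shape needed for the bracket summand of [rho_T]. *)
Lemma hl_jacobi_leibniz (k : fieldType) (g : homLieAlgebra k) (x y z : g) :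
  hl_bracket g (hl_bracket g x y) (hl_twist g z)
  = hl_bracket g (hl_twist g x) (hl_bracket g y z)
    - hl_bracket g (hl_twist g y) (hl_bracket g x z).
Proof.
rewrite hl_bracket_skew; apply/eqP; rewrite eq_sym -addr_eq0; apply/eqP.
by rewrite -hl_bracketNr -hl_bracket_skew hl_jacobi.
Qed.

Section InducedRepresentation.

Variables (k : fieldType) (g : homLieAlgebra k) (V : lmodType k).
Variables (beta : {linear V -> V}) (rho : g -> V -> V) (T : {linear V -> g}).
Hypothesis rhoP : representation beta rho.

Lemma rep_addl x y v : rho (x + y) v = rho x v + rho y v.
Proof.
have [/(_ v 1 x y) /= E _] := rep_bilinear rhoP.
by rewrite !scale1r in E.
Qed.

Lemma rep_subr x u v : rho x (u - v) = rho x u - rho x v.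
Proof.
have [_ /(_ x (-1) v u) /= E] := rep_bilinear rhoP.
by rewrite !scaleN1r in E; rewrite addrC E addrC.
Qed.

Lemma rho_T_bilinear : bilinear_for *:%R *:%R (rho_T rho T).
Proof.
have [rhol rhor] := rep_bilinear rhoP.
have [brl brr] := hl_bracket_bilinear g.
split=> [x a u v | v a x y]; rewrite /rho_T /=.
  have /= -> := rhor x a u v; rewrite !linearP.
  by have /= -> := brl x a (T u) (T v); rewrite scalerDr addrACA.
have /= -> := rhol v a x y; have /= -> := brr (T v) a x y.
by rewrite linearP scalerDr addrACA.
Qed.

Hypothesis TP : O_operator beta rho T.

Lemma rho_T_twist v x :
  rho_T rho T (beta v) (hl_twist g x) = hl_twist g (rho_T rho T v x).
Proof.
rewrite /rho_T (O_twist TP) (rep_twist rhoP) (O_twist TP).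
by rewrite linearD hl_twist_bracket.
Qed.

Lemma rho_T_comp v w x :
  rho_T rho T (beta v) (rho_T rho T w x)
  = hl_bracket g (hl_twist g (T v)) (hl_bracket g (T w) x)
    + T (rho (hl_twist g (T v)) (rho x w) + rho (hl_twist g (T w)) (rho x v)
         - rho (hl_twist g x) (rho (T w) v)).
Proof.
(* Folding [hl_twist g (T v)] back on the right makes both sides speak of [T (beta v)]; [O_bracket]
   then puts the bracket with [T (rho x w)] under [T]. *)
rewrite /rho_T hl_bracketDr rep_addl -(O_twist TP v) (O_bracket TP).
rewrite (rep_bracket rhoP) -addrA -linearD; congr (_ + T _).
by rewrite (addrC _ (rho (T _) (beta v))) addrA subrK addrA.
Qed.

Lemma rho_T_bracket v w x :
  rho_T rho T (subadjacent_bracket rho T v w) (hl_twist g x)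
  = rho_T rho T (beta v) (rho_T rho T w x)
    - rho_T rho T (beta w) (rho_T rho T v x).
Proof.
rewrite !rho_T_comp /rho_T /subadjacent_bracket /preLie_product.
(* [T] sends the sub-adjacent bracket to [[T v, T w]], so the Leibniz form applies to its bracket
   with [hl_twist g x]. *)
rewrite -(O_bracket TP) hl_jacobi_leibniz rep_subr opprD addrACA -linearB.
(* The swap gives both mixed sums the same form [S], so that [(S - c) - (S - d)] collapses to
   [d - c]. *)
congr (_ + T _); rewrite (addrC (rho _ (rho x v))) opprB.
by rewrite [RHS]addrC subrKA.
Qed.

End InducedRepresentation.

Theorem proposition3p12 (k : fieldType) (char_k : [pchar k] =i pred0)
    (g : homLieAlgebra k) (V : lmodType k) (beta : {linear V -> V})
    (rho : g -> V -> V) (rhoP : representation beta rho)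
    (T : {linear V -> g}) (TP : O_operator beta rho T) :
  @representation k (subadjacent rhoP TP) g (hl_twist g) (rho_T rho T).
Proof.
split; first exact: rho_T_bilinear rhoP.
  exact: rho_T_twist rhoP TP.
exact: rho_T_bracket rhoP TP.
Qed.
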